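(* The best coupled rank-$k$ approximation of two matrices $X\in\mathbb{R}^{m\times n_1}$ and $Y\in\mathbb{R}^{m\times n_2}$ is equivalent to the best rank-$k$ approximation of the matrix $\begin{bmatrix} X & Y\end{bmatrix}\in\mathbb{R}^{m\times(n_1+n_2)}$.
   Context: $\|\cdot\|_F$ denotes the Frobenius norm, and $\begin{bmatrix} X & Y\end{bmatrix}$ is the block matrix obtained by placing $X$ and $Y$ side by side. A coupled rank-$k$ approximation of $X\in\mathbb{R}^{m\times n_1}$ and $Y\in\mathbb{R}^{m\times n_2}$ is a pair of approximations $X\approx UV^T$, $Y\approx UW^T$ with a shared factor $U\in\mathbb{R}^{m\times k}$ and with $V\in\mathbb{R}^{n_1\times k}$, $W\in\mathbb{R}^{n_2\times k}$; the best one minimizes $\|X-UV^T\|_F^2+\|Y-UW^T\|_F^2$ over all such $U,V,W$. The best rank-$k$ approximation of $\begin{bmatrix} X & Y\end{bmatrix}$ is the approximation $UZ^T$ minimizing $\|\begin{bmatrix} X & Y\end{bmatrix}-UZ^T\|_F^2$ over all $U\in\mathbb{R}^{m\times k}$ and $Z\in\mathbb{R}^{(n_1+n_2)\times k}$. *)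

(* Defs.v *)
From HB Require Import structures.
From mathcomp Require Import all_boot all_order all_algebra.
From mathcomp Require Import reals.

Set Implicit Arguments.
Unset Strict Implicit.
Unset Printing Implicit Defensive.

Import Order.TTheory GRing.Theory Num.Theory.
Local Open Scope ring_scope.

(* The norm `|A| that the analysis library puts on matrices is the max norm. *)
Definition frobenius_norm (R : realType) (m n : nat) (A : 'M[R]_(m, n)) : R :=
  Num.sqrt (\sum_(i < m) \sum_(j < n) `|A i j| ^+ 2).

Definition approx_error (R : realType) (m n k : nat) (M : 'M[R]_(m, n))
    (U : 'M[R]_(m, k)) (Z : 'M[R]_(n, k)) : R :=
  frobenius_norm (M - U *m Z^T) ^+ 2.

Definition coupled_error (R : realType) (m n1 n2 k : nat)
    (X : 'M[R]_(m, n1)) (Y : 'M[R]_(m, n2))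
    (U : 'M[R]_(m, k)) (V : 'M[R]_(n1, k)) (W : 'M[R]_(n2, k)) : R :=
  frobenius_norm (X - U *m V^T) ^+ 2 + frobenius_norm (Y - U *m W^T) ^+ 2.

Definition best_factors (R : realType) (m n k : nat) (M : 'M[R]_(m, n))
    (U : 'M[R]_(m, k)) (Z : 'M[R]_(n, k)) : Prop :=
  forall (U' : 'M[R]_(m, k)) (Z' : 'M[R]_(n, k)),
    approx_error M U Z <= approx_error M U' Z'.

Definition best_coupled_factors (R : realType) (m n1 n2 k : nat)
    (X : 'M[R]_(m, n1)) (Y : 'M[R]_(m, n2))
    (U : 'M[R]_(m, k)) (V : 'M[R]_(n1, k)) (W : 'M[R]_(n2, k)) : Prop :=
  forall (U' : 'M[R]_(m, k)) (V' : 'M[R]_(n1, k)) (W' : 'M[R]_(n2, k)),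
    coupled_error X Y U V W <= coupled_error X Y U' V' W'.

(* "Rank-k" means having a factorization through dimension k (rank <= k). *)
Definition best_approx (R : realType) (m n k : nat)
    (M N : 'M[R]_(m, n)) : Prop :=
  exists (U : 'M[R]_(m, k)) (Z : 'M[R]_(n, k)),
    N = U *m Z^T /\ best_factors M U Z.

Definition best_coupled_approx (R : realType) (m n1 n2 k : nat)
    (X : 'M[R]_(m, n1)) (Y : 'M[R]_(m, n2))
    (A : 'M[R]_(m, n1)) (B : 'M[R]_(m, n2)) : Prop :=
  exists (U : 'M[R]_(m, k)) (V : 'M[R]_(n1, k)) (W : 'M[R]_(n2, k)),
    [/\ A = U *m V^T, B = U *m W^T & best_coupled_factors X Y U V W].

(* Main.v *)
Require Import Defs.
From HB Require Import structures.
From mathcomp Require Import all_boot all_order all_algebra.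
From mathcomp Require Import reals.

Set Implicit Arguments.
Unset Strict Implicit.
Unset Printing Implicit Defensive.

Import Order.TTheory GRing.Theory Num.Theory.
Local Open Scope ring_scope.

(** The squared Frobenius norm is a sum over entries, so it is additive over side-by-side blocks,
    and [U *m (col_mx V W)^T] has blocks [U *m V^T] and [U *m W^T]. Hence the two objectives agree
    under [Z = col_mx V W] ([coupled_errorE]). Since stacking is a bijection from pairs [(V, W)] to
    matrices [Z], the minimizers correspond ([best_coupled_factorsE]), and so do the products they
    yield. *)

Lemma frobenius_norm_row_mx (R : realType) (m n1 n2 : nat)
    (A : 'M[R]_(m, n1)) (B : 'M[R]_(m, n2)) :
  frobenius_norm (row_mx A B) ^+ 2 =
  frobenius_norm A ^+ 2 + frobenius_norm B ^+ 2.
Proof.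
(* Nonnegativity lets squaring cancel [Num.sqrt], which is 0 on negative arguments. *)
have ssq_ge0 n (C : 'M[R]_(m, n)) : 0 <= \sum_(i < m) \sum_(j < n) `|C i j| ^+ 2.
  by apply: sumr_ge0 => i _; apply: sumr_ge0 => j _; rewrite exprn_ge0.
rewrite /frobenius_norm !sqr_sqrtr //.
rewrite -big_split /=; apply: eq_bigr => i _; rewrite big_split_ord /=.
by congr (_ + _); apply: eq_bigr => j _; rewrite ?row_mxEl ?row_mxEr.
Qed.

Lemma mul_tr_col_mx (R : comNzRingType) (m n1 n2 k : nat)
    (U : 'M[R]_(m, k)) (V : 'M[R]_(n1, k)) (W : 'M[R]_(n2, k)) :
  U *m (col_mx V W)^T = row_mx (U *m V^T) (U *m W^T).
Proof. by rewrite tr_col_mx mul_mx_row. Qed.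

Lemma coupled_errorE (R : realType) (m n1 n2 k : nat)
    (X : 'M[R]_(m, n1)) (Y : 'M[R]_(m, n2))
    (U : 'M[R]_(m, k)) (V : 'M[R]_(n1, k)) (W : 'M[R]_(n2, k)) :
  coupled_error X Y U V W = approx_error (row_mx X Y) U (col_mx V W).
Proof.
by rewrite /approx_error mul_tr_col_mx opp_row_mx add_row_mx frobenius_norm_row_mx.
Qed.

(** Equal objectives alone are not enough: the competitors must match too. Every [Z'] splits as
    [col_mx (usubmx Z') (dsubmx Z')], so no uncoupled competitor is missed. *)
Lemma best_coupled_factorsE (R : realType) (m n1 n2 k : nat)
    (X : 'M[R]_(m, n1)) (Y : 'M[R]_(m, n2))
    (U : 'M[R]_(m, k)) (V : 'M[R]_(n1, k)) (W : 'M[R]_(n2, k)) :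
  best_coupled_factors X Y U V W <-> best_factors (row_mx X Y) U (col_mx V W).
Proof.
split=> best U' => [Z'|V' W']; last by rewrite !coupled_errorE.
by rewrite -(vsubmxK Z') -!coupled_errorE.
Qed.

Theorem corollary2p2 (R : realType) (m n1 n2 k : nat)
    (X : 'M[R]_(m, n1)) (Y : 'M[R]_(m, n2)) :
  [/\ forall (U : 'M[R]_(m, k)) (V : 'M[R]_(n1, k)) (W : 'M[R]_(n2, k)),
        coupled_error X Y U V W = approx_error (row_mx X Y) U (col_mx V W),
      forall (U : 'M[R]_(m, k)) (V : 'M[R]_(n1, k)) (W : 'M[R]_(n2, k)),
        best_coupled_factors X Y U V W <->
        best_factors (row_mx X Y) U (col_mx V W),
      forall (U : 'M[R]_(m, k)) (Z : 'M[R]_(n1 + n2, k)),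
        best_factors (row_mx X Y) U Z <->
        best_coupled_factors X Y U (usubmx Z) (dsubmx Z) &
      forall (A : 'M[R]_(m, n1)) (B : 'M[R]_(m, n2)),
        best_coupled_approx k X Y A B <->
        best_approx k (row_mx X Y) (row_mx A B)].
Proof.
split=> [U V W|U V W|U Z|A B].
- exact: coupled_errorE.
- exact: best_coupled_factorsE.
- by rewrite best_coupled_factorsE vsubmxK.
split=> [[U [V [W [-> -> best]]]]|[U [Z [AB_eq best]]]].
  exists U, (col_mx V W); rewrite mul_tr_col_mx; split=> //.
  exact/best_coupled_factorsE.
(* Once [Z] is split into its halves, both sides of [AB_eq] are block rows, and injectivity of
   [row_mx] recovers [A] and [B] separately. *)
move: AB_eq best; rewrite -(vsubmxK Z) mul_tr_col_mx => /eq_row_mx[-> ->] best.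
by exists U, (usubmx Z), (dsubmx Z); split=> //; apply/best_coupled_factorsE.
Qed.
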